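(* Let $X$ be a real locally convex topological vector space and let $f\colon X\to(-\infty,\infty]$ be a convex function. Then $$\operatorname{iri}\big(\operatorname{epi}(f)\big)=\big\{(x,\lambda)\in X\times\mathbb{R}\;\big|\;x\in\operatorname{iri}\big(\operatorname{dom}(f)\big),\;\lambda>f(x)\big\}.$$
   Context: For a nonempty subset $A$ of a real locally convex topological vector space $Z$, $\operatorname{cone}(A):=\{ta\mid t\ge 0,\ a\in A\}$. For a nonempty convex set $\Omega\subset Z$, the intrinsic relative interior is $\operatorname{iri}(\Omega):=\{x\in\Omega\mid \operatorname{cone}(\Omega-x)\text{ is a linear subspace of }Z\}$; by convention $\operatorname{iri}(\emptyset)=\emptyset$. For $f\colon X\to(-\infty,\infty]$, $\operatorname{dom}(f):=\{x\in X\mid f(x)<\infty\}$ and $\operatorname{epi}(f):=\{(x,\alpha)\in X\times\mathbb{R}\mid \alpha\ge f(x)\}$; $f$ is convex if $\operatorname{epi}(f)$ is a convex set. *)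

(* Defs.v *)
From HB Require Import structures.
From mathcomp Require Import all_boot all_order all_algebra.
From mathcomp Require Import all_classical all_reals ereal topology normedtype convex.

Set Implicit Arguments.
Unset Strict Implicit.
Unset Printing Implicit Defensive.

Import Order.TTheory GRing.Theory Num.Theory.
Import numFieldNormedType.Exports.

Local Open Scope classical_set_scope.
Local Open Scope ring_scope.

Definition cone (R : realType) (Z : tvsType R) (A : set Z) : set Z :=
  [set z | exists t : R, exists a : Z, [/\ 0 <= t, A a & z = t *: a]].

(* Intrinsic relative interior. The notion is only meant for convex sets; in
   particular [iri set0 = set0], as membership in [Omega] is required. *)
Definition iri (R : realType) (Z : tvsType R) (Omega : set Z) : set Z :=
  [set x | Omega x /\ submod_closed [in cone [set w - x | w in Omega]]].

Definition effdom (R : realType) (X : tvsType R) (f : X -> \bar R) : set X :=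
  [set x | (f x < +oo)%E].

(* [R^o] is [R] as a locally convex space over itself, so that [X * R^o] carries
   the library's product structure. *)
Definition epi (R : realType) (X : tvsType R) (f : X -> \bar R) :
    set (X * R^o)%type :=
  [set z | (f z.1 <= (z.2 : R)%:E)%E].

Definition econvex (R : realType) (X : tvsType R) (f : X -> \bar R) : Prop :=
  convex_set (epi f).

(* Main.v *)
Require Import Defs.
From HB Require Import structures.
From mathcomp Require Import all_boot all_order all_algebra.
From mathcomp Require Import all_classical all_reals ereal topology normedtype convex.
From mathcomp Require Import lra.

(** The proof rests on the prolongation criterion: for convex [Omega],
    [x \in iri Omega] iff every segment from a point [w] of [Omega] to [x] can
    be prolonged beyond [x] inside [Omega]. For a point [(x, l)] of [iri (epi f)],
    prolonging downwards from [(x, l + 1)] gives [f x < l]. Conversely, if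
    [f x < l] and the segment from [w] to [x] is prolonged to [y] in the domain,
    then convexity bounds [f] above along the segment from [x] to [y] by an
    affine function starting at [f x < l], so a short enough prolongation of the
    segment from [(w, m)] to [(x, l)] stays in the epigraph. *)

Import Order.TTheory GRing.Theory Num.Theory.
Import numFieldNormedType.Exports.

Local Open Scope classical_set_scope.
Local Open Scope ring_scope.

(** The weight in [convex_set] has an interval type; two real weights are handier below. *)
Lemma convex_set_comb (R : numDomainType) (M : lmodType R) (A : set M)
    (x y : M) (p q : R) :
  convex_set A -> A x -> A y -> 0 <= p -> 0 <= q -> p + q = 1 ->
  A (p *: x + q *: y).
Proof.
move=> cA Ax Ay p0 q0 pq1.
have p1 : p <= 1 by rewrite -pq1 lerDl.
have -> : q = 1 - p by rewrite -pq1 addrAC subrr add0r.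
by have := cA x y (Itv01 p0 p1); rewrite !inE => /(_ Ax Ay).
Qed.

Section iri_theory.
Variables (R : realType) (Z : tvsType R).
Implicit Types (A Omega : set Z) (x u v w : Z).

Lemma coneZ A u (a : R) : 0 <= a -> cone A u -> cone A (a *: u).
Proof.
move=> a0 [t [b [t0 Ab ->]]]; exists (a * t), b.
by rewrite mulr_ge0// scalerA.
Qed.

(** For [p], [q] in [Omega], [s (p - x) + t (q - x)] is [s + t] times [r - x], where [r] is the
    convex combination of [p] and [q] with weights proportional to [s] and [t]. These weights make
    sense only if [s + t] is nonzero. *)
Lemma convex_coneD Omega x u v : convex_set Omega ->
  cone [set w - x | w in Omega] u -> cone [set w - x | w in Omega] v ->
  cone [set w - x | w in Omega] (u + v).
Proof.
move=> cO [s [_ [s0 [p Op <-] ->]]] [t [_ [t0 [q Oq <-] ->]]].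
have [st0|st0] := eqVneq (s + t) 0.
  have [-> ->] : s = 0 /\ t = 0 by split; lra.
  exists 0, (p - x); split => //; first by exists p.
  by rewrite !scale0r addr0.
exists (s + t), ((s / (s + t)) *: p + (t / (s + t)) *: q - x); split.
- by rewrite addr_ge0.
- eexists; last reflexivity.
  by apply: convex_set_comb => //; rewrite ?divr_ge0 ?addr_ge0// -mulrDl divff.
- rewrite !scalerBr scalerDr !scalerA !(mulrCA (s + t)) divff// !mulr1.
  by rewrite scalerDl opprD addrACA.
Qed.

(** The cone is closed under sums and nonnegative scaling, so only opposites matter, and prolonging
    from [w] beyond [x] puts a positive multiple of [- (w - x)] in it. *)
Lemma iri_prolong Omega x : convex_set Omega ->
  iri Omega x <-> Omega x /\
    forall w, Omega w -> exists2 e : R, 0 < e & Omega (x - e *: (w - x)).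
Proof.
move=> cO; split=> -[Ox].
  move=> [C0 Clin]; split=> // w Ow.
  have Cw : w - x \in cone [set w - x | w in Omega].
    by rewrite inE; exists 1, (w - x); split; [|exists w|rewrite scale1r].
  have := Clin (- 1) (w - x) 0 Cw C0; rewrite inE addr0 scaleN1r.
  (* Now [- (w - x) = t (y - x)]: if [t = 0] then [w = x] and any step stays at [x]; otherwise the
     step [t^-1] lands on [y]. *)
  move=> [t [_ [t0 [y Oy <-] e]]]; have [tE|tn0] := eqVneq t 0.
    exists 1 => //.
    by rewrite scale1r e tE scale0r addr0.
  exists t^-1; first by rewrite invr_gt0 lt0r tn0.
  by rewrite -scalerN e scalerA mulVf// scale1r addrC subrK.
move=> prolong; split=> //.
have CN u : cone [set w - x | w in Omega] u ->
    cone [set w - x | w in Omega] (- u).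
  move=> [t [_ [t0 [w Ow <-] ->]]].
  have [e e0 Oe] := prolong w Ow.
  exists (t / e), (- (e *: (w - x))); split.
  - by rewrite divr_ge0// ltW.
  - by exists (x - e *: (w - x)) => //; rewrite addrC addKr.
  - by rewrite scalerN scalerA divfK// gt_eqF.
split.
  rewrite inE; exists 0, (x - x); split => //; first by exists x.
  by rewrite scale0r.
move=> a u v; rewrite !inE => Cu Cv; apply: convex_coneD => //.
have [a0|a0] := leP 0 a; first exact: coneZ.
rewrite -[a]opprK scaleNr -scalerN; apply: coneZ; last exact: CN.
by rewrite oppr_ge0 ltW.
Qed.

End iri_theory.

Section epigraph.
Variables (R : realType) (X : tvsType R) (f : X -> \bar R).
Hypothesis f_gtNy : forall x : X, (-oo < f x)%E.
Hypothesis f_convex : econvex f.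

Lemma effdom_fin x : effdom f x -> exists a : R, f x = a%:E.
Proof.
by rewrite /effdom/=; have := f_gtNy x; case: (f x) => // r _ _; exists r.
Qed.

Lemma epi_comb (x y : X) (a b p q : R) :
  epi f (x, a) -> epi f (y, b) -> 0 <= p -> 0 <= q -> p + q = 1 ->
  epi f (p *: x + q *: y, p * a + q * b).
Proof. exact: (@convex_set_comb _ (X * R^o)%type _ (x, a) (y, b)). Qed.

Lemma convex_effdom : convex_set (effdom f).
Proof.
move=> x y p; rewrite !inE => /effdom_fin[a fa] /effdom_fin[b fb].
have p01 : p%:num + (1 - p%:num) = 1 by rewrite addrC subrK.
have /= := @epi_comb x y a b p%:num (1 - p%:num).
rewrite /epi/= fa fb !lexx subr_ge0 => /(_ isT isT _ _ p01) fc.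
by apply: le_lt_trans (fc _ _) (ltry _).
Qed.

Lemma iri_epiP (x : X) (l : R) :
  iri (epi f) (x, l) <-> iri (effdom f) x /\ (f x < l%:E)%E.
Proof.
rewrite iri_prolong// iri_prolong; last exact: convex_effdom.
split.
  move=> [fxl prolong]; split; last first.
    (* The prolonged point is [(x, l - e)], whence [f x <= l - e]. *)
    have [|e e0] := prolong (x, l + 1).
      by apply: (le_trans fxl); rewrite lee_fin lerDl.
    rewrite /epi/= subrr scaler0 subr0 => /le_lt_trans; apply.
    by rewrite lte_fin addrAC subrr add0r /GRing.scale/=; lra.
  split; first exact: (le_lt_trans fxl (ltry _)).
  move=> w /effdom_fin[b fb].
  (* Lift [w] to the graph, prolong there, and project back to the domain. *)
  have [|e e0 xe] := prolong (w, b); first by rewrite /epi/= fb.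
  by exists e => //; exact: (le_lt_trans xe (ltry _)).
move=> [[dx prolong] fxl]; split; first exact: ltW.
move=> [w m] fwm.
have [e e0 /effdom_fin[b fb]] := prolong w (le_lt_trans fwm (ltry _)).
have [a fa] := effdom_fin _ dx.
have al : a < l by rewrite -lte_fin -fa.
(* [s] solves [s * (|c| + (l - a)) = l - a], so that [a + s c <= l]. *)
pose c := b - a + e * (m - l).
have d0 : 0 < `|c| + (l - a) by rewrite ltr_wpDl// subr_gt0.
pose s := (l - a) / (`|c| + (l - a)).
have s0 : 0 < s by rewrite divr_gt0// subr_gt0.
have s1 : s <= 1 by rewrite ler_pdivrMr// mul1r lerDr.
have sc : s * c <= l - a.
  apply: (@le_trans _ _ (s * (`|c| + (l - a)))); last by rewrite divfK ?gt_eqF.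
  by rewrite ler_pM2l//; have := ler_norm c; lra.
(* The new base point is [(1 - s) x + s (x - e (w - x))], where [f] is at most [(1 - s) a + s b].
   This is at most the new height [l - s e (m - l)] exactly when [s c <= l - a]. *)
exists (s * e); first exact: mulr_gt0.
have /= := @epi_comb x (x - e *: (w - x)) a b (1 - s) s.
rewrite /epi/= fa fb !lexx subr_ge0 (ltW s0) s1 subrK => /(_ isT isT isT isT erefl).
rewrite scalerBr addrA -scalerDl subrK scale1r scalerA => /le_trans; apply.
by rewrite lee_fin /GRing.scale/= -subr_ge0; move: sc; rewrite /c; nra.
Qed.

End epigraph.

Theorem theorem5p4 (R : realType) (X : tvsType R) (f : X -> \bar R)
    (f_gtNy : forall x : X, (-oo < f x)%E)
    (f_convex : econvex f) :
  iri (epi f) =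
  [set z : (X * R^o)%type |
    iri (effdom f) z.1 /\ (f z.1 < (z.2 : R)%:E)%E].
Proof. by apply/seteqP; split=> -[x l] /(iri_epiP _ _ _ f_gtNy f_convex). Qed.
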